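(* Let $q$ be a prime power, $F=\mathbb{F}_{q^2}$, and let $G$ be a finite abelian group of odd order $n$ with $\gcd(n,q)=1$. Fix $\gamma\in F$ with $\frac1n+\gamma^{q+1}=0$. Let $C=I_X$ be an ideal of $F[G^*]$, where $X\subseteq G$ is a union of $\langle\tau_{q^2}\rangle$-orbits. Then the extended code $\widetilde{C}$ is Hermitian self-dual if and only if $C$ is a split group code for some splitting $(Z=\{0\},X_0,X_1)$ of $G$ by $-q$ (that is, $C=I_{X_0}$ for some such splitting).
   Context: $G$ is written additively, with exponent $m$. $K$ is the smallest extension of $F=\mathbb{F}_{q^2}$ containing all $m$-th roots of unity, and $G^*$ is the group of all characters (homomorphisms) $\psi:G\to K^\times$. $F[G^*]$ is the group algebra of $G^*$ over $F$; an element $f=\sum_{\psi\in G^*}a_\psi\psi$ is also viewed as a function $G\to K$ by $f(x)=\sum_\psi a_\psi\psi(x)$ (so $f(0)=\sum_\psi a_\psi\in F$). For an integer $s$, $\tau_s:G\to G$ is $x\mapsto sx$. Since $\gcd(n,q)=1$, $\tau_{q^2}$ is an automorphism of $G$ and $\langle\tau_{q^2}\rangle$ partitions $G$ into orbits. For $X\subseteq G$ put $I_X=\{f\in F[G^*]: f(x)=0 \text{ for all } x\in X\}$. Every ideal of $F[G^*]$ is $I_X$ for a unique union $X$ of $\langle\tau_{q^2}\rangle$-orbits. A splitting of $G$ by $-q$ over $Z=\{0\}$ is a triple $(\{0\},X_0,X_1)$ such that $G$ is the disjoint union of $\{0\},X_0,X_1$ and $\tau_{-q}(X_0)=X_1$,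 $\tau_{-q}(X_1)=X_0$ (the sets $X_0,X_1$ are then automatically unions of $\langle\tau_{q^2}\rangle$-orbits). The split group code associated with it is $C_0=I_{X_0}$. The extended code of $C\subseteq F[G^*]$ is $\widetilde{C}=\{(f,-\gamma f(0)): f\in C\}\subseteq F[G^*]\times F$. The Hermitian inner product of $(\sum a_\psi\psi,\,a)$ and $(\sum b_\psi\psi,\,b)$ in $F[G^*]\times F$ is $\sum_\psi a_\psi b_\psi^q+ab^q$. A code is Hermitian self-dual if it equals its dual with respect to this product. *)

(* Defs.v *)
From HB Require Import structures.
From mathcomp Require Import all_boot all_order all_algebra.
From mathcomp Require Import all_fingroup all_solvable all_field.

Set Implicit Arguments.
Unset Strict Implicit.
Unset Printing Implicit Defensive.

Import GRing.Theory.
Local Open Scope ring_scope.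

(** The group algebra F[A] of a finite group A, with the convolution product.
    It is an alias of [{ffun A -> F}] because the latter carries the pointwise
    product; the element \sum_a f_a a is the function a |-> f_a. *)

Definition group_algebra (F : fieldType) (A : finGroupType) : predArgType :=
  {ffun A -> F}.

HB.instance Definition _ (F : fieldType) (A : finGroupType) :=
  GRing.Lmodule.copy (group_algebra F A) {ffun A -> F^o}.

Section GroupAlgebraRing.
Variables (F : fieldType) (A : finGroupType).
Implicit Types f g h : group_algebra F A.

Definition ga_coef f (a : A) : F := (f : {ffun A -> F}) a.
Definition ga_one : group_algebra F A := [ffun a => (a == 1%g)%:R].
Definition ga_mul f g : group_algebra F A :=
  [ffun a => \sum_(b : A) ga_coef f b * ga_coef g (b^-1 * a)%g].

Fact ga_mulA : associative ga_mul.
Proof.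
move=> f g h; apply/ffunP=> a; rewrite !ffunE.
under eq_bigr do rewrite /ga_coef ffunE mulr_sumr.
under [RHS]eq_bigr do rewrite /ga_coef ffunE mulr_suml.
rewrite [RHS]exchange_big /=; apply: eq_bigr => b _.
rewrite [RHS](reindex_inj (mulgI b)) /=; apply: eq_bigr => c _.
by rewrite /ga_coef mulrA !invMg !mulgA mulVg mul1g.
Qed.

Fact ga_mulLid : left_id ga_one ga_mul.
Proof.
move=> f; apply/ffunP=> a; rewrite ffunE (bigD1 1%g) //= big1 => [|b nb1].
  by rewrite /ga_coef ffunE eqxx mul1r invg1 mul1g addr0.
by rewrite /ga_coef ffunE (negPf nb1) mul0r.
Qed.

Fact ga_mulRid : right_id ga_one ga_mul.
Proof.
move=> f; apply/ffunP=> a; rewrite ffunE (bigD1 a) //= big1 => [|b nba].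
  by rewrite /ga_coef ffunE mulVg eqxx mulr1 addr0.
by rewrite /ga_coef ffunE -eq_mulVg1 (negPf nba) mulr0.
Qed.

Fact ga_mulDl : left_distributive ga_mul +%R.
Proof.
move=> f g h; apply/ffunP=> a; rewrite !ffunE -big_split /=.
by apply: eq_bigr => b _; rewrite /ga_coef !ffunE mulrDl.
Qed.

Fact ga_mulDr : right_distributive ga_mul +%R.
Proof.
move=> f g h; apply/ffunP=> a; rewrite !ffunE -big_split /=.
by apply: eq_bigr => b _; rewrite /ga_coef !ffunE mulrDr.
Qed.

Fact ga_one_neq0 : ga_one != 0.
Proof.
by apply/eqP=> /ffunP/(_ 1%g)/eqP; rewrite !ffunE eqxx oner_eq0.
Qed.

HB.instance Definition _ := GRing.Zmodule_isNzRing.Build (group_algebra F A)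
  ga_mulA ga_mulLid ga_mulRid ga_mulDl ga_mulDr ga_one_neq0.

End GroupAlgebraRing.

HB.instance Definition _ (F : finFieldType) (A : finGroupType) :=
  Finite.copy (group_algebra F A) {ffun A -> F}.

(** Not [idealr_closed], which is restricted to proper ideals. *)
Definition is_ideal (R : finNzRingType) (C : {set R}) : Prop :=
  [/\ 0 \in C,
      {in C &, forall f g, f - g \in C}
    & forall a, {in C, forall f, a * f \in C /\ f * a \in C}].

(** The group G^* of characters G -> K^x, under the pointwise product.  [K] is
    a finite extension of [F]; [finvect_type K] is the same field, with its
    [finType] structure. *)

Definition is_character (F : finFieldType) (K : fieldExtType F)
    (G : finZmodType) (psi : {ffun G -> finvect_type K}) : bool :=
  [forall x, psi x != 0] && [forall x, forall y, psi (x + y) == psi x * psi y].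

Definition dual (F : finFieldType) (K : fieldExtType F) (G : finZmodType) :
    predArgType :=
  {psi : {ffun G -> finvect_type K} | is_character psi}.

HB.instance Definition _ (F : finFieldType) (K : fieldExtType F)
  (G : finZmodType) :=
  SubFinite.copy (dual K G)
    {psi : {ffun G -> finvect_type K} | is_character psi}.

Section DualGroup.
Variables (F : finFieldType) (K : fieldExtType F) (G : finZmodType).
Implicit Types psi phi : dual K G.

Definition chi psi (x : G) : K := val psi x.

Lemma chi_neq0 psi x : chi psi x != 0.
Proof. by case/andP: (valP psi) => /forallP/(_ x). Qed.

Lemma chiD psi x y : chi psi (x + y) = chi psi x * chi psi y.
Proof. by case/andP: (valP psi) => _ /forallP/(_ x)/forallP/(_ y)/eqP. Qed.

Lemma chi0 psi : chi psi 0 = 1.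
Proof.
by apply: (mulfI (chi_neq0 psi 0)); rewrite -chiD addr0 mulr1.
Qed.

Fact dual_one_subproof : is_character ([ffun=> 1] : {ffun G -> finvect_type K}).
Proof.
apply/andP; split; apply/forallP=> x; first by rewrite ffunE oner_neq0.
by apply/forallP=> y; rewrite !ffunE mulr1.
Qed.

Fact dual_mul_subproof psi phi :
  is_character ([ffun x => chi psi x * chi phi x] : {ffun G -> finvect_type K}).
Proof.
apply/andP; split; apply/forallP=> x.
  by rewrite ffunE mulf_neq0 ?chi_neq0.
by apply/forallP=> y; rewrite !ffunE !chiD mulrACA.
Qed.

Fact dual_inv_subproof psi :
  is_character ([ffun x => (chi psi x)^-1] : {ffun G -> finvect_type K}).
Proof.
apply/andP; split; apply/forallP=> x; first by rewrite ffunE invr_eq0 chi_neq0.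
by apply/forallP=> y; rewrite !ffunE chiD invfM.
Qed.

Definition dual_one : dual K G := Sub _ dual_one_subproof.
Definition dual_mul psi phi : dual K G := Sub _ (dual_mul_subproof psi phi).
Definition dual_inv psi : dual K G := Sub _ (dual_inv_subproof psi).

Fact dual_mulA : associative dual_mul.
Proof.
by move=> a b c; apply/val_inj/ffunP=> x; rewrite /= /chi /= !ffunE mulrA.
Qed.

Fact dual_mulLid : left_id dual_one dual_mul.
Proof.
by move=> a; apply/val_inj/ffunP=> x; rewrite /= /chi /= !ffunE mul1r.
Qed.

Fact dual_mulV : left_inverse dual_one dual_inv dual_mul.
Proof.
move=> a; apply/val_inj/ffunP=> x; rewrite /= !ffunE /chi /= !ffunE.
by rewrite mulVf // -/(chi a x) chi_neq0.
Qed.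

HB.instance Definition _ :=
  Finite_isGroup.Build (dual K G) dual_mulA dual_mulLid dual_mulV.

End DualGroup.

Section Codes.
Variables (F : finFieldType) (K : fieldExtType F) (G : finZmodType).
Local Notation FG := (group_algebra F (dual K G)).
Implicit Types f g : FG.

Definition ga_eval f (x : G) : K :=
  \sum_(psi : dual K G) (ga_coef f psi)%:A * chi psi x.

(* f(0), as an element of the base field: see [ga_eval0]. *)
Definition ga_aug f : F := \sum_(psi : dual K G) ga_coef f psi.

Lemma ga_eval0 f : ga_eval f 0 = (ga_aug f)%:A.
Proof.
rewrite /ga_aug scaler_suml; apply: eq_bigr => psi _.
by rewrite chi0 mulr1.
Qed.

Lemma ga_evalB f g x : ga_eval (f - g) x = ga_eval f x - ga_eval g x.
Proof.
rewrite /ga_eval -sumrB; apply: eq_bigr => psi _.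
by rewrite /ga_coef !ffunE scalerBl mulrBl.
Qed.

Lemma ga_evalM f g x : ga_eval (f * g) x = ga_eval f x * ga_eval g x.
Proof.
rewrite /ga_eval mulr_suml.
under eq_bigr do rewrite /ga_coef ffunE scaler_suml mulr_suml.
rewrite exchange_big /=; apply: eq_bigr => phi _.
rewrite (reindex_inj (mulgI phi)) mulr_sumr; apply: eq_bigr => psi _.
rewrite mulKg /chi /= ffunE -/(chi phi x) -/(chi psi x) mulrACA.
by rewrite -!in_algE rmorphM.
Qed.

Definition vanishing_ideal (X : {set G}) : {set FG} :=
  [set f | [forall x in X, ga_eval f x == 0]].

Lemma vanishing_idealP X : is_ideal (vanishing_ideal X).
Proof.
have inI f : reflect {in X, forall x, ga_eval f x = 0} (f \in vanishing_ideal X).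
  by rewrite inE; apply: (iffP forall_inP) => h x /h/eqP.
split=> [|f g /inI f0 /inI g0|a f /inI f0].
- apply/inI=> x _; apply: big1 => psi _.
  by rewrite /ga_coef ffunE scale0r mul0r.
- by apply/inI=> x Xx; rewrite ga_evalB f0 ?g0 ?subr0.
by split; apply/inI=> x Xx; rewrite ga_evalM f0 ?mulr0 ?mul0r.
Qed.

Definition extended_code (gamma : F) (C : {set FG}) : {set FG * F} :=
  [set (f, - (gamma * ga_aug f)) | f in C].

Definition herm_dot (q : nat) (u v : FG * F) : F :=
  \sum_(psi : dual K G) ga_coef u.1 psi * ga_coef v.1 psi ^+ q + u.2 * v.2 ^+ q.

Definition herm_dual (q : nat) (D : {set FG * F}) : {set FG * F} :=
  [set u | [forall v in D, herm_dot q u v == 0]].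

Definition herm_self_dual (q : nat) (D : {set FG * F}) : Prop :=
  D = herm_dual q D.

End Codes.

Section Splittings.
Variable G : finZmodType.

Definition tau (s : int) (x : G) : G := x *~ s.

(* The set of <tau_s>-orbits, for tau_s an automorphism of G. *)
Definition tau_orbits (s : int) : {set {set G}} :=
  [set [set y in fingraph.orbit (tau s) x] | x in [set: G]].

Definition union_of_orbits (s : int) (X : {set G}) : Prop :=
  exists2 P : {set {set G}}, P \subset tau_orbits s & X = cover P.

Definition splitting (s : int) (Z X0 X1 : {set G}) : Prop :=
  [/\ Z :|: X0 :|: X1 = [set: G],
      [/\ [disjoint Z & X0], [disjoint Z & X1] & [disjoint X0 & X1]],
      [set tau s x | x in X0] = X1
    & [set tau s x | x in X1] = X0].

End Splittings.

Definition split_group_code (F : finFieldType) (K : fieldExtType F)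
    (G : finZmodType) (s : int) (Z : {set G})
    (C : {set group_algebra F (dual K G)}) : Prop :=
  exists X0 X1 : {set G}, splitting s Z X0 X1 /\ C = vanishing_ideal K X0.

(* Main.v *)
Require Import Defs.
From HB Require Import structures.
From mathcomp Require Import all_boot all_order all_algebra.
From mathcomp Require Import all_fingroup all_solvable all_field all_character.
From mathcomp Require Import ring.

Import GRing.Theory FinRing.Theory.
Local Open Scope ring_scope.

(** Everything is read off from the values f(x) instead of the coefficients
    of f.  Orthogonality of characters turns the Hermitian product into
      <(f, a), (g, b)> = 1/n \sum_y f(-q y) g(y)^q + a b^q
    ([herm_dotE]): raising to the power q is additive on K and sends psi(y) to
    psi(q y), so the conjugation of coefficients becomes the map tau_{-q} on
    points.  When b = - gamma g(0), the relation 1/n = - gamma^(q+1) makes the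
    term y = 0 combine with the extension coordinate, leaving
      1/n \sum_(y != 0) f(-q y) g(y)^q - gamma^q (a + gamma f(0)) g(0)^q
    ([herm_dot_extended]).

    Let X be stable under tau_{q^2}.  The group algebra F[G^*] then contains
    the indicator function of the complement of X ([indicator_exists]) and its
    products with all characters, which is enough to separate the terms of the
    sum above ([eq0_of_chi_sum]).  Hence (f, a) is orthogonal to the extended
    code of I_X exactly when f(-q y) = 0 for all y != 0 outside X and, if 0 is
    outside X, a = - gamma f(0) ([herm_dual_extended]).  The extended code
    itself is given by f = 0 on X and a = - gamma f(0).  Testing these two
    descriptions on indicator functions shows that they agree if and only if,
    for all x,
      -q x \in X  <->  x != 0 and x \notin X
    ([self_dual_iff]), and this says that X is the first half of a splitting
    ([splitting_mem]).

    Orthogonality requires that the characters with values in K separate the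
    points of G ([dual_separates]).  For this the regular representation of G
    is diagonalized over K, which is possible because 'X^m - 1 has m distinct
    roots in K; the diagonal entries are characters, and an element on which
    all of them are 1 acts trivially. *)

(** * Characters with values in K separate points *)

Section Separation.
Set Implicit Arguments.
Unset Strict Implicit.
Variables (F : finFieldType) (K : fieldExtType F) (G : finZmodType).
Local Notation m := (exponent [set: G]).
Hypothesis card_neq0 : #|G|%:R != 0 :> K.
Hypothesis K_split : splittingFieldFor 1%VS ('X^m - 1 : {poly K}) fullv.

Lemma exponent_neq0 : m%:R != 0 :> K.
Proof.
have /dvdnP[d dE] := exponent_dvdn [set: G].
by apply: contraNneq card_neq0 => m0; rewrite -cardsT dE natrM m0 mulr0.
Qed.

(** The minimal polynomial divides 'X^m - 1, which splits over K and is
    separable because m is invertible in K. *)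
Lemma diagonalizable_unity_root n (A : 'M[K]_n.+1) :
  A ^+ m = 1 -> diagonalizable A.
Proof.
move=> Am; have [rs rsE _] := K_split; apply/diagonalizableP; exists rs.
  rewrite -separable_prod_XsubC -(eqp_separable rsE).
  exact: separable_Xn_sub_1 exponent_neq0.
rewrite -(eqp_dvdr _ rsE); apply: mxminpoly_min.
by rewrite rmorphB rmorphXn rmorph1 /= horner_mx_X Am subrr.
Qed.

Lemma repr_codiagonalizable n (rG : mx_representation K [set: G] n) :
  codiagonalizable [seq rG x | x <- enum G].
Proof.
apply/codiagonalizableP; split=> [_ _ /mapP[x _ ->] /mapP[y _ ->]|].
  by rewrite /comm_mx -!repr_mxM ?inE // !zmodMgE addrC.
case: n rG => [|n] rG _ /mapP[x _ ->].
  by rewrite [rG x]thinmx0; exact: diagonalizable0.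
apply: diagonalizable_unity_root.
by rewrite -repr_mxX ?inE // expg_exponent ?inE // repr_mx1.
Qed.

Lemma dual_of_morphism (psi : G -> K) :
  (forall x, psi x != 0) -> {morph psi : x y / x + y >-> x * y} ->
  exists phi : dual K G, forall x, chi phi x = psi x.
Proof.
move=> psi0 psiD.
have psiP : is_character ([ffun x => psi x] : {ffun G -> finvect_type K}).
  apply/andP; split; apply/forallP=> x; first by rewrite ffunE; exact: psi0.
  by apply/forallP=> y; rewrite !ffunE; apply/eqP; exact: psiD.
by exists (Sub _ psiP) => x; rewrite /chi SubK ffunE.
Qed.

(** The diagonal entries of the diagonalized regular representation are
    characters; if they are all 1 at x, then x acts as the identity, and so
    x = 0 because the regular representation is faithful. *)
Lemma dual_separates (x : G) : x != 0 -> exists psi : dual K G, chi psi x != 1.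
Proof.
move=> x_neq0; pose rG := regular_repr K [set: G].
have [P Pu /allP Pdiag] := repr_codiagonalizable rG.
pose D y := P *m rG y *m invmx P.
have DM y z : D (y + z) = D y *m D z.
  by rewrite /D -zmodMgE repr_mxM ?inE // !mulmxA mulmxKV.
have D0 : D 0 = 1%:M by rewrite /D -zmod1gE repr_mx1 mulmx1 mulmxV.
have Dd y i j : i != j -> D y i j = 0.
  have : similar_diag P (rG y) by apply: Pdiag; apply: map_f; rewrite mem_enum.
  by move/(similar_diagP _ Pu); apply.
have Ddiag i : {morph (fun y => D y i i) : y z / y + z >-> y * z}.
  move=> y z; rewrite /= DM mxE (bigD1 i) //= big1 ?addr0 // => j ji.
  by rewrite Dd ?mul0r // eq_sym.
have Dnz i y : D y i i != 0.
  apply: contra_eq_neq (Ddiag i y (- y)) => /= ->.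
  by rewrite subrr D0 mxE eqxx mul0r oner_eq0.
have [/forallP allD1|] := boolP [forall i, D x i i == 1]; last first.
  case/forallPn => i xi.
  have [psi psiE] := dual_of_morphism (Dnz i) (Ddiag i).
  by exists psi; rewrite psiE.
have Dx1 : D x = 1%:M.
  apply/matrixP=> i j; rewrite [RHS]mxE.
  by case: (eqVneq i j) => [<-|/Dd->//]; exact/eqP.
have rx1 : rG x = 1%:M.
  have := congr1 (fun M => invmx P *m M *m P) Dx1.
  by rewrite /D mulmx1 mulVmx // !mulmxA mulVmx // mul1mx mulmxKV.
(* The row of the regular representation at the neutral element is the basis
   vector indexed by x. *)
have /rowP/(_ (gring_index [set: G] x)) :=
  congr1 (row (gring_index [set: G] 1%g)) rx1.
rewrite rowK gring_indexK ?inE // mul1g !mxE !eqxx /=.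
rewrite (inj_in_eq (can_in_inj (@gring_indexK _ _))) ?inE //.
by rewrite eq_sym zmod1gE (negPf x_neq0) => /eqP; rewrite oner_eq0.
Qed.

End Separation.

(** * Multiplication by integers on G and splittings *)

Section Multiplication.
Set Implicit Arguments.
Variable G : finZmodType.

Lemma mulrn_inj k : coprime #|G| k -> injective (fun x : G => x *+ k).
Proof.
rewrite -cardsT => coGk.
apply: (can_inj (g := fun x => x *+ expg_invn [set: G] k)).
by move=> x; rewrite -!zmodXgE expgK ?inE.
Qed.

Lemma mulrn_eq0_coprime k (x : G) : coprime #|G| k -> (x *+ k == 0) = (x == 0).
Proof. by move=> /mulrn_inj inj; rewrite -[RHS](inj_eq inj) mul0rn. Qed.

Lemma tauN q (x : G) : tau (- q%:Z) x = - (x *+ q).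
Proof. by rewrite /tau mulrNz. Qed.

Lemma tauNN q (x : G) : tau (- q%:Z) (tau (- q%:Z) x) = x *+ (q ^ 2).
Proof. by rewrite !tauN mulNrn opprK -mulrnA. Qed.

Lemma tauN_inj q : coprime #|G| q -> injective (tau (G := G) (- q%:Z)).
Proof. by move=> coGq x y; rewrite !tauN => /oppr_inj/mulrn_inj; apply. Qed.

Lemma tauN0 q (x : G) : coprime #|G| q -> (tau (- q%:Z) x == 0) = (x == 0).
Proof. by move=> coGq; rewrite tauN oppr_eq0 mulrn_eq0_coprime. Qed.

Lemma union_of_orbits_stable k (X : {set G}) :
  coprime #|G| k -> union_of_orbits k%:Z X ->
  forall x, (x *+ k \in X) = (x \in X).
Proof.
move=> coGk [P /subsetP sP ->] x; rewrite -[x *+ k]/(tau k%:Z x).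
have inj : injective (tau (G := G) k%:Z) by apply: mulrn_inj.
have tauB B : B \in P -> (tau k%:Z x \in B) = (x \in B).
  move=> /sP/imsetP[z _ ->]; rewrite !inE -!fingraph.fconnect_orbit.
  by rewrite -fingraph.same_fconnect1_r.
apply/bigcupP/bigcupP=> -[B PB]; rewrite ?tauB // => xB;
  by exists B; rewrite ?tauB.
Qed.

(** Since G is the disjoint union of {0}, X and X1, the set X1 must be the set
    of nonzero elements outside X; and tau_{-q} is a bijection, so the two
    conditions on images are conditions on membership.  Those for X and for X1
    are equivalent. *)
Lemma splitting_mem q (X : {set G}) : coprime #|G| q ->
  (exists X1, splitting (- q%:Z) [set 0] X X1) <->
  (forall x, (tau (- q%:Z) x \in X) = (x != 0) && (x \notin X)).
Proof.
move=> coGq; have inj := tauN_inj coGq.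
split=> [[X1 [defG [d0 d1 dX] X01 X10]]|tauX].
  have X1E x : (x \in X1) = (x != 0) && (x \notin X).
    have [->|x0] := eqVneq x 0; first by rewrite (disjointFr d1) // set11.
    case: (boolP (x \in X)) => [/(disjointFr dX)-> //|xX].
    by have := in_setT x; rewrite -defG !inE (negPf x0) (negPf xX).
  by move=> x; rewrite -{1}X10 mem_imset ?X1E.
exists [set x | (x != 0) && (x \notin X)].
have X0 : 0 \notin X by have := tauX 0; rewrite eqxx tauN mul0rn oppr0 => ->.
have surj (y : G) : exists z, y = tau (- q%:Z) z.
  by have [g _ gK] := injF_bij inj; exists (g y); rewrite gK.
split=> //.
- by apply/setP=> x; rewrite !inE; case: (x == 0) => //=; case: (x \in X).
- split; rewrite -setI_eq0; apply/eqP/setP=> x; rewrite !inE.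
  + by case: eqP => // ->; rewrite (negPf X0).
  + by case: eqP.
  + by case: (x \in X); rewrite ?andbF.
- apply/setP=> _y; have [y ->] := surj _y.
  rewrite mem_imset // inE tauN0 // tauX negb_and !negbK.
  by case: eqP => [->|//]; rewrite (negPf X0).
- apply/setP=> _y; have [y ->] := surj _y.
  by rewrite mem_imset // inE tauX.
Qed.

End Multiplication.

(** * Powers of the characteristic *)

Section FrobeniusPower.
Set Implicit Arguments.

Lemma expr0_pchar (R : nzRingType) q : [pchar R].-nat q -> 0 ^+ q = 0 :> R.
Proof. by case/andP; case: q => // q _ _; rewrite exprS mul0r. Qed.

Lemma exprn_sum (R : comNzRingType) q (I : finType) (P : pred I) (E : I -> R) :
  [pchar R].-nat q -> (\sum_(i | P i) E i) ^+ q = \sum_(i | P i) E i ^+ q.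
Proof.
move=> q_pchar; have q0 := expr0_pchar q_pchar.
by apply: (big_morph (fun x : R => x ^+ q) _ q0) => x y; apply: exprDn_pchar.
Qed.

(** 'X^#|F| - 'X has at most #|F| roots in an extension of F, and the elements
    of F are #|F| of them. *)
Lemma card_fixed_base (F : finFieldType) (K : fieldExtType F) (z : K) :
  z ^+ #|F| = z -> exists a : F, z = a%:A.
Proof.
move=> zF; have: root (map_poly (in_alg K) ('X^#|F| - 'X)) z.
  by rewrite rmorphB /= map_polyXn map_polyX rootE !hornerE zF subrr.
rewrite finField_genPoly rmorph_prod rootE horner_prod => /prodf_eq0[a _].
by rewrite rmorphB /= map_polyX map_polyC !hornerE subr_eq0 => /eqP->; exists a.
Qed.

End FrobeniusPower.

(** * Orthogonality of characters *)

Section Fourier.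
Set Implicit Arguments.
Unset Strict Implicit.
Variables (F : finFieldType) (K : fieldExtType F) (G : finZmodType).
Hypothesis separates :
  forall (x : G), x != 0 -> exists psi : dual K G, chi psi x != 1.
Hypothesis card_neq0 : #|G|%:R != 0 :> F.
Local Notation FG := (group_algebra F (dual K G)).
Implicit Types (psi phi : dual K G) (f g : FG) (x y : G).

Lemma chiM psi phi x : chi (psi * phi)%g x = chi psi x * chi phi x.
Proof. by rewrite /chi /= ffunE. Qed.

Lemma chi1 x : chi (1%g : dual K G) x = 1.
Proof. by rewrite /chi /= ffunE. Qed.

Lemma chiV psi x : chi psi^-1%g x = (chi psi x)^-1.
Proof. by rewrite /chi /= ffunE. Qed.

Lemma chiN psi x : chi psi (- x) = (chi psi x)^-1.
Proof.
by apply: (mulfI (chi_neq0 psi x)); rewrite -chiD subrr chi0 divff ?chi_neq0.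
Qed.

Lemma chiMn psi x k : chi psi (x *+ k) = chi psi x ^+ k.
Proof.
by elim: k => [|k IHk]; rewrite ?mulr0n ?chi0 // mulrS chiD IHk exprS.
Qed.

Lemma card_neq0K : #|G|%:R != 0 :> K.
Proof. by rewrite -(rmorph_nat (in_alg K)) fmorph_eq0. Qed.

Lemma alg_eq0 (a : F) : (a%:A == 0 :> K) = (a == 0).
Proof. by rewrite scaler_eq0 oner_eq0 orbF. Qed.

Lemma sum_chi_point psi : \sum_x chi psi x = #|G|%:R * (psi == 1%g)%:R.
Proof.
have [->|psi_neq1] := eqVneq psi 1%g.
  by rewrite mulr1 (eq_bigr _ (fun x _ => chi1 x)) sumr_const.
have [x psix] : exists x, chi psi x != 1.
  apply/existsP; apply: contra_neqT psi_neq1 => /existsPn psi1.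
  apply/val_inj/ffunP=> x.
  rewrite -[LHS]/(chi psi x) -[RHS]/(chi (1%g : dual K G) x).
  by rewrite chi1; apply/eqP; have := psi1 x; rewrite negbK.
rewrite mulr0; apply/eqP; have: (chi psi x - 1) * \sum_y chi psi y = 0.
  rewrite mulrBl mul1r mulr_sumr; apply/eqP; rewrite subr_eq0; apply/eqP.
  rewrite [RHS](reindex_inj (addrI x)); apply: eq_bigr => y _.
  by rewrite chiD.
by move/eqP; rewrite mulf_eq0 subr_eq0 (negPf psix).
Qed.

Lemma sum_chi_dual_neq0 x : x != 0 -> \sum_(psi : dual K G) chi psi x = 0.
Proof.
move=> /separates[phi phix]; apply/eqP.
have: (chi phi x - 1) * \sum_psi chi psi x = 0.
  rewrite mulrBl mul1r mulr_sumr; apply/eqP; rewrite subr_eq0; apply/eqP.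
  rewrite [RHS](reindex_inj (mulgI phi)); apply: eq_bigr => psi _.
  by rewrite chiM.
by move/eqP; rewrite mulf_eq0 subr_eq0 (negPf phix).
Qed.

(** Sum psi(x) over all pairs (psi, x) in both orders: only psi = 1
    contributes in one order, and only x = 0 in the other.  An equality of
    scalars is all that Fourier inversion over K asks for. *)
Lemma card_dual : #|{: dual K G}|%:R = #|G|%:R :> K.
Proof.
have: \sum_(psi : dual K G) \sum_(x : G) chi psi x
      = \sum_(x : G) \sum_(psi : dual K G) chi psi x.
  exact: exchange_big.
rewrite (bigD1 1%g) //= sum_chi_point eqxx mulr1.
rewrite big1 => [|psi /negPf psi1]; last by rewrite sum_chi_point psi1 mulr0.
rewrite addr0 (bigD1 0) //= [X in _ + X]big1 => [|x]; last first.
  exact: sum_chi_dual_neq0.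
by rewrite addr0 (eq_bigr _ (fun psi _ => chi0 psi)) sumr_const => ->.
Qed.

Lemma sum_chi_dual x :
  \sum_(psi : dual K G) chi psi x = #|G|%:R * (x == 0)%:R.
Proof.
have [->|/sum_chi_dual_neq0->] := eqVneq x 0; last by rewrite mulr0.
by rewrite mulr1 (eq_bigr _ (fun psi _ => chi0 psi)) sumr_const card_dual.
Qed.

Definition monomial psi : FG := [ffun phi => (phi == psi)%:R].

Lemma eval_monomial psi x : ga_eval (monomial psi) x = chi psi x.
Proof.
rewrite /ga_eval (bigD1 psi) //= big1 => [|phi /negPf psi'].
  by rewrite /ga_coef ffunE eqxx scale1r mul1r addr0.
by rewrite /ga_coef ffunE psi' scale0r mul0r.
Qed.

(** * The Hermitian product in terms of values *)

Variable q : nat.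
Hypothesis q_pchar : [pchar K].-nat q.

(** Multiplying by psi(-x)^q and summing over psi isolates the term y = x, by
    the q-th power of the orthogonality relation at y - x. *)
Lemma eq0_of_chi_sum (c : G -> K) :
  (forall psi, \sum_y c y * chi psi y ^+ q = 0) -> forall y, c y = 0.
Proof.
move=> c0 x.
have: \sum_psi chi psi (- x) ^+ q * (\sum_y c y * chi psi y ^+ q) = 0.
  by apply: big1 => psi _; rewrite c0 mulr0.
under eq_bigr do rewrite mulr_sumr.
rewrite exchange_big /= (bigD1 x) //= [X in _ + X]big1 => [|y yx].
  under eq_bigr do rewrite mulrCA -exprMn -chiD addNr chi0 expr1n.
  rewrite -mulr_sumr sumr_const card_dual addr0 => /eqP.
  by rewrite mulf_eq0 (negPf card_neq0K) orbF => /eqP.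
under eq_bigr do rewrite mulrCA -exprMn -chiD.
rewrite -mulr_sumr -(exprn_sum _ _ q_pchar) sum_chi_dual addrC subr_eq0.
by rewrite (negPf yx) mulr0 (expr0_pchar q_pchar) mulr0.
Qed.

(** Expanding f(-q y) g(y)^q over the coefficients of f and g, the pair
    (psi, phi) contributes a_psi b_phi^q (phi / psi)(y)^q, whose sum over y
    vanishes unless phi = psi. *)
Lemma herm_dotE f a g b :
  (herm_dot q (f, a) (g, b))%:A =
  #|G|%:R^-1 * (\sum_y ga_eval f (tau (- q%:Z) y) * ga_eval g y ^+ q)
  + (a * b ^+ q)%:A.
Proof.
rewrite /herm_dot scalerDl /=; congr (_ + _).
apply: (mulfI card_neq0K); rewrite mulVKf ?card_neq0K //.
rewrite scaler_suml mulr_sumr; symmetry.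
transitivity (\sum_y \sum_psi \sum_phi
    (ga_coef f psi * ga_coef g phi ^+ q)%:A * chi (phi * psi^-1)%g y ^+ q).
  apply: eq_bigr => y _.
  rewrite /ga_eval (exprn_sum _ _ q_pchar) mulr_suml.
  apply: eq_bigr => psi _; rewrite mulr_sumr; apply: eq_bigr => phi _.
  rewrite tauN chiN chiMn chiM chiV !exprMn exprVn -!in_algE rmorphM rmorphXn /=.
  by rewrite mulrACA [_^-1 * _]mulrC.
rewrite exchange_big; apply: eq_bigr => psi _.
rewrite exchange_big (bigD1 psi) //= [X in _ + X]big1 => [|phi phipsi].
  under eq_bigr do rewrite mulgV chi1 expr1n mulr1.
  by rewrite sumr_const addr0 mulr_natl.
rewrite -mulr_sumr -(exprn_sum _ _ q_pchar) sum_chi_point -eq_mulgV1.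
by rewrite (negPf phipsi) mulr0 (expr0_pchar q_pchar) mulr0.
Qed.

Hypothesis coGq : coprime #|G| q.
Hypothesis cardF : #|F| = (q ^ 2)%N.

(** Fourier inversion gives the coefficient 1/n \sum_(y in S) psi(-y) at psi.
    It lies in F because raising it to the power #|F| permutes the points of
    S, which is stable under multiplication by q^2. *)
Lemma indicator_exists (S : {set G}) :
  (forall x, (x *+ (q ^ 2) \in S) = (x \in S)) ->
  exists e : FG, forall x, ga_eval e x = (x \in S)%:R.
Proof.
move=> S_stable.
pose c psi : K := #|G|%:R^-1 * \sum_(y in S) chi psi (- y).
have [a aE] : exists a : dual K G -> F, forall psi, c psi = (a psi)%:A.
  apply: (@fin_all_exists _ (fun=> F) (fun psi b => c psi = b%:A)) => psi.
  apply: card_fixed_base; rewrite /c exprMn; congr (_ * _).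
    by rewrite -(rmorph_nat (in_alg K)) -fmorphV -rmorphXn expf_card.
  rewrite cardF exprn_sum ?pnatX ?q_pchar //.
  have inj : injective (fun y : G => y *+ (q ^ 2)).
    by apply: mulrn_inj; rewrite coprimeXr.
  rewrite [RHS](reindex_inj inj) /=.
  apply: eq_big => y; first by rewrite S_stable.
  by rewrite -mulNrn chiMn.
exists [ffun psi => a psi] => x; rewrite /ga_eval.
transitivity (\sum_(psi : dual K G) c psi * chi psi x).
  by apply: eq_bigr => psi _; rewrite /ga_coef ffunE aE.
transitivity
  (#|G|%:R^-1 * \sum_(y in S) \sum_(psi : dual K G) chi psi (x - y)).
  rewrite exchange_big mulr_sumr; apply: eq_bigr => psi _.
  rewrite -mulrA mulr_suml.
  by congr (_ * _); apply: eq_bigr => y _; rewrite chiD mulrC.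
under eq_bigr do rewrite sum_chi_dual.
rewrite -mulr_sumr mulKf ?card_neq0K //.
have [xS|xS] := boolP (x \in S).
  rewrite (bigD1 x) //= subrr eqxx big1 ?addr0 // => y /andP[_ yx].
  by rewrite subr_eq0 eq_sym (negPf yx).
rewrite big1 // => y yS.
by rewrite subr_eq0; case: eqP => // xy; rewrite xy yS in xS.
Qed.

(** * Extended codes and their duals *)

Variable gamma : F.
Hypothesis gammaP : #|G|%:R^-1 + gamma ^+ q.+1 = 0.

Lemma gamma_neq0 : gamma != 0.
Proof.
apply: contraTneq isT => g0; have /eqP := gammaP.
by rewrite g0 expr0n addr0 invr_eq0 (negPf card_neq0).
Qed.

Lemma mem_extended_code (C : {set FG}) f a :
  ((f, a) \in extended_code gamma C) =
    (f \in C) && (a == - (gamma * ga_aug f)).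
Proof.
apply/imsetP/andP=> [[g gC [-> ->]]|[fC /eqP->]]; first by rewrite eqxx.
by exists f.
Qed.

Lemma mem_vanishing_ideal (X : {set G}) f :
  reflect (forall x, x \in X -> ga_eval f x = 0) (f \in vanishing_ideal K X).
Proof. by rewrite inE; apply: (iffP forall_inP) => h x /h/eqP. Qed.

(** Since 1/n = - gamma^(q+1), the term y = 0 of the sum over points is
    - gamma^(q+1) f(0) g(0)^q, a multiple of g(0)^q like the contribution
    - gamma^q a g(0)^q of the extension coordinate. *)
Lemma herm_dot_extended f a g :
  (herm_dot q (f, a) (g, - (gamma * ga_aug g)))%:A =
  #|G|%:R^-1 *
    (\sum_(y | y != 0) ga_eval f (tau (- q%:Z) y) * ga_eval g y ^+ q)
  - (gamma ^+ q * (a + gamma * ga_aug f))%:A * ga_eval g 0 ^+ q.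
Proof.
rewrite herm_dotE (bigD1 0) //= tauN mul0rn oppr0 !ga_eval0.
have -> : #|G|%:R^-1 = - (gamma ^+ q.+1)%:A :> K.
  move/eqP: gammaP; rewrite addr_eq0 -!in_algE -rmorphN => /eqP<-.
  by rewrite fmorphV rmorph_nat.
rewrite exprNn_pchar -?(eq_pnat _ (pchar_lalg K)) //.
rewrite -!in_algE !(rmorphXn, rmorphM, rmorphN, rmorphD, exprMn) /= exprS.
by ring.
Qed.

(** For necessity, take g to be the indicator of {0} (when 0 is outside X),
    which isolates the last term of [herm_dot_extended], and the products of
    the indicator of the nonzero points outside X with each character, which
    make the sum over y != 0 vanish term by term. *)
Lemma herm_dual_extended (X : {set G}) f a :
  (forall x, (x *+ (q ^ 2) \in X) = (x \in X)) ->
  reflect ((forall y, y != 0 -> y \notin X -> ga_eval f (tau (- q%:Z) y) = 0)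
            /\ (0 \notin X -> a = - (gamma * ga_aug f)))
    ((f, a) \in herm_dual q (extended_code gamma (vanishing_ideal K X))).
Proof.
move=> X_stable; rewrite inE.
apply: (iffP forall_inP) => [orth | [fX aX] [g b]]; last first.
  rewrite mem_extended_code => /andP[/mem_vanishing_ideal gX /eqP->].
  rewrite -alg_eq0 herm_dot_extended big1 => [|y y0].
    have [/gX->|/aX->] := boolP (0 \in X).
      by rewrite (expr0_pchar q_pchar) !mulr0 subrr.
    by rewrite addNr !mulr0 scale0r mul0r subrr.
  have [/gX->|/(fX _ y0)->] := boolP (y \in X); last by rewrite mul0r.
  by rewrite (expr0_pchar q_pchar) mulr0.
have orthI g : (forall x, x \in X -> ga_eval g x = 0) ->
  #|G|%:R^-1 *
    (\sum_(y | y != 0) ga_eval f (tau (- q%:Z) y) * ga_eval g y ^+ q)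
  - (gamma ^+ q * (a + gamma * ga_aug f))%:A * ga_eval g 0 ^+ q = 0.
  move=> gX; rewrite -herm_dot_extended; apply/eqP; rewrite alg_eq0.
  apply: orth; rewrite mem_extended_code eqxx andbT.
  exact/mem_vanishing_ideal.
split=> [y y0 yX | X0]; last first.
  have [x|e eE] := indicator_exists (S := [set 0]).
    by rewrite !inE mulrn_eq0_coprime ?coprimeXr.
  have/orthI : forall x, x \in X -> ga_eval e x = 0.
    move=> x xX; rewrite eE inE; case: eqP => // x0.
    by case/negP: X0; rewrite x0 in xX.
  rewrite eE set11 expr1n mulr1 big1 => [|y /negPf y0].
    rewrite mulr0 sub0r => /eqP; rewrite oppr_eq0 alg_eq0 mulf_eq0.
    by rewrite expf_eq0 (negPf gamma_neq0) andbF addr_eq0 => /eqP.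
  by rewrite eE inE y0 (expr0_pchar q_pchar) mulr0.
have [x|e eE] := indicator_exists (S := ~: X :\ 0).
  by rewrite !inE X_stable mulrn_eq0_coprime ?coprimeXr.
pose c z := (z \in ~: X :\ 0)%:R * ga_eval f (tau (- q%:Z) z).
suff /(_ y) : forall z, c z = 0 by rewrite /c !inE y0 yX mul1r.
apply: eq0_of_chi_sum => psi.
have egX x : x \in X -> ga_eval (e * monomial psi) x = 0.
  by move=> xX; rewrite ga_evalM eE !inE xX andbF mul0r.
have := orthI _ egX.
rewrite ga_evalM eE !inE eqxx /= mul0r (expr0_pchar q_pchar) mulr0 subr0.
move/eqP; rewrite mulf_eq0 invr_eq0 (negPf card_neq0K) /= => /eqP sum0.
rewrite (bigD1 0) //= {1}/c !inE eqxx !mul0r add0r -[RHS]sum0.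
apply: eq_bigr => z z0; rewrite ga_evalM eval_monomial eE /c exprMn.
rewrite mulrCA -!mulrA; case: (z \in _); first by rewrite !mul1r expr1n mul1r.
by rewrite (expr0_pchar q_pchar) !mul0r.
Qed.

(** The two implications of the right-hand side come from the two inclusions
    between the code and its dual, tested on indicator functions: that of the
    complement of X lies in the code, hence in the dual; that of the set of
    x in X with -q x in X, extended by 0, lies in the dual, hence in the code,
    so this set is empty.  As -q 0 = 0, the latter also excludes 0 from X. *)
Lemma self_dual_iff (X : {set G}) :
  (forall x, (x *+ (q ^ 2) \in X) = (x \in X)) ->
  herm_self_dual q (extended_code gamma (vanishing_ideal K X)) <->
  (forall x, (tau (- q%:Z) x \in X) = (x != 0) && (x \notin X)).
Proof.
move=> X_stable; split=> [sd|tauX].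
  have codeE := herm_dual_extended _ _ X_stable; rewrite -sd in codeE.
  have tauX_stable x :
      (tau (- q%:Z) (x *+ q ^ 2) \in X) = (tau (- q%:Z) x \in X).
    by rewrite -[RHS]X_stable !tauN mulNrn mulrnAC.
  have X_tau x : x \in X -> tau (- q%:Z) x \notin X.
    pose S := X :&: [set x | tau (- q%:Z) x \in X].
    have [y|e eE] := indicator_exists (S := S).
      by rewrite !inE X_stable tauX_stable.
    have /codeE :
        (forall y, y != 0 -> y \notin X -> ga_eval e (tau (- q%:Z) y) = 0)
        /\ (0 \notin X -> 0 = - (gamma * ga_aug e)).
      split=> [y _ yX|X0].
        by rewrite eE !inE tauNN X_stable (negPf yX) andbF.
      suff -> : ga_aug e = 0 by rewrite mulr0 oppr0.
      by apply/eqP; rewrite -alg_eq0 -ga_eval0 eE !inE (negPf X0).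
    rewrite mem_extended_code => /andP[/mem_vanishing_ideal e0 _] xX.
    apply/negP => tX; have /eqP := e0 x xX.
    by rewrite eE !inE xX tX oner_eq0.
  have tau_X x : x != 0 -> x \notin X -> tau (- q%:Z) x \in X.
    move=> x0 xX; have [y|e eE] := indicator_exists (S := ~: X).
      by rewrite !inE X_stable.
    have : (e, - (gamma * ga_aug e))
             \in extended_code gamma (vanishing_ideal K X).
      rewrite mem_extended_code eqxx andbT; apply/mem_vanishing_ideal=> y yX.
      by rewrite eE inE yX.
    case/codeE=> /(_ x x0 xX)/eqP + _.
    by rewrite eE inE; case: (_ \in X); rewrite ?oner_eq0.
  move=> x; have [->|x0] := eqVneq x 0.
    rewrite tauN mul0rn oppr0; apply/negP=> X0; have := X_tau _ X0.
    by rewrite tauN mul0rn oppr0 X0.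
  by have [/X_tau/negPf|/tau_X->] := boolP (x \in X).
have X0 : 0 \notin X by have := tauX 0; rewrite eqxx tauN mul0rn oppr0 => ->.
apply/setP=> -[f a]; apply/idP/herm_dual_extended => //.
  rewrite mem_extended_code => /andP[/mem_vanishing_ideal fX /eqP->].
  by split=> // y y0 yX; apply: fX; rewrite tauX y0.
case=> fX /(_ X0)->; rewrite mem_extended_code eqxx andbT.
apply/mem_vanishing_ideal=> x xX; have [g _ gK] := injF_bij (tauN_inj coGq).
by rewrite -(gK x) in xX *; move: xX; rewrite tauX => /andP[]; exact: fX.
Qed.

End Fourier.

(** * The equivalence *)

Theorem corollary3p7
    (p k q : nat) (p_prime : prime p) (k_gt0 : (0 < k)%N) (q_def : q = (p ^ k)%N)
    (F : finFieldType) (cardF : #|F| = (q ^ 2)%N)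
    (G : finZmodType) (G_odd : odd #|G|) (coGq : coprime #|G| q)
    (K : fieldExtType F)
    (K_split : splittingFieldFor 1%VS ('X^(exponent [set: G]) - 1 : {poly K})
                 fullv)
    (gamma : F) (gammaP : #|G|%:R^-1 + gamma ^+ q.+1 = 0)
    (X : {set G}) (X_orb : union_of_orbits (q ^ 2)%N%:Z X)
    (C : {set group_algebra F (dual K G)}) (C_ideal : is_ideal C)
    (C_def : C = vanishing_ideal K X) :
  herm_self_dual q (extended_code gamma C)
  <-> split_group_code (- q%:Z) [set 0] C.
Proof.
have p_pchar : p \in [pchar F].
  by apply: (card_finPcharP (n := (k * 2)%N)) => //; rewrite cardF q_def expnM.
have q_pchar : [pchar K].-nat q.
  rewrite (eq_pnat _ (pchar_lalg K)) q_def pnatX (eq_pnat _ (pcharf_eq p_pchar)).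
  by rewrite pnat_id.
have card_neq0 : #|G|%:R != 0 :> F.
  rewrite -(dvdn_pcharf p_pchar) -prime_coprime // coprime_sym.
  by move: coGq; rewrite q_def coprime_pexpr.
have separates := dual_separates (card_neq0K K card_neq0) K_split.
have self_dualE (Y : {set G}) :
    (forall x, (x *+ (q ^ 2) \in Y) = (x \in Y)) ->
    herm_self_dual q (extended_code gamma (vanishing_ideal K Y)) <->
    (forall x, (tau (- q%:Z) x \in Y) = (x != 0) && (x \notin Y)).
  by move=> Y_stable; exact: self_dual_iff.
have X_stable := union_of_orbits_stable (coprimeXr 2 coGq) X_orb.
split=> [|[X0 [X1 [X01 ->]]]].
  rewrite C_def => /(self_dualE _ X_stable) /(splitting_mem _ coGq)[X1 X01].
  by exists X, X1.
have tauX : forall x, (tau (- q%:Z) x \in X0) = (x != 0) && (x \notin X0).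
  by apply/(splitting_mem _ coGq); exists X1.
(* X0 need not be X as given, so its stability under multiplication by q^2 is
   obtained by applying the splitting condition twice. *)
apply/self_dualE => // x.
have tau0 := tauX 0; rewrite eqxx tauN mul0rn oppr0 in tau0.
rewrite -tauNN tauX tauX tauN0 //.
have [->|_] := eqVneq x 0; first by rewrite tau0.
by rewrite /= negbK.
Qed.
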